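(* Let $\mathcal M=(\mathcal D,x)$ be a minimal time-like surface in $\mathbb R^4_2$, parametrized by isothermal coordinates $(u,v)\in\mathcal D$. Then $x$ is given locally in the form $x(u,v)=\mathrm{Re}\,\Psi(t)$, where $\Psi$ is a holomorphic $\mathbb D^4_2$-valued function of $t=u+\mathrm jv$ satisfying the conditions \[ \Psi'^{\,2}=0,\qquad \|\Psi'\|^2<0 . \] Conversely, if $\Psi$ is a holomorphic $\mathbb D^4_2$-valued function, defined in a domain $\mathcal D\subset\mathbb D$ and satisfying $\Psi'^{\,2}=0$, $\|\Psi'\|^2<0$, then the pair $(\mathcal D,x)$ with $x=\mathrm{Re}\,\Psi$ is a minimal time-like surface in $\mathbb R^4_2$ in isothermal coordinates $(u,v)$, $t=u+\mathrm jv$.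
   Context: All maps are smooth; domains are open and connected. $\mathbb R^4_2$ is $\mathbb R^4$ with scalar product $a\cdot b=-a_1b_1+a_2b_2-a_3b_3+a_4b_4$; $a^2=a\cdot a$. Double numbers: $\mathbb D=\{t=u+\mathrm jv:u,v\in\mathbb R\}$ with $\mathrm j^2=1$, $\bar t=u-\mathrm jv$, $\mathrm{Re}\,t=u$; $\mathbb R^2$ is identified with $\mathbb D$; $\frac{\partial}{\partial t}=\frac12(\frac{\partial}{\partial u}+\mathrm j\frac{\partial}{\partial v})$, $\frac{\partial}{\partial\bar t}=\frac12(\frac{\partial}{\partial u}-\mathrm j\frac{\partial}{\partial v})$. A function $f$ is holomorphic if $\partial f/\partial\bar t=0$; then $f'=\partial f/\partial t$. $\mathbb D^4_2$ is $\mathbb D^4$ with the $\mathbb D$-bilinear extension of the scalar product, $a^2=a\cdot a\in\mathbb D$, $\|a\|^2=a\cdot\bar a\in\mathbb R$. A time-like surface $(\mathcal D,x)$ is an immersion $x:\mathcal D\to\mathbb R^4_2$ whose induced scalar product on tangent planes is indefinite (signature $(1,1)$). Coordinates $(u,v)$ are isothermal if $x_u^2=-x_v^2$ and $x_u\cdot x_v=0$; always with $E=x_u^2<0$. The surface is minimal if $H=\frac12(-\sigma(X_1,X_1)+\sigma(X_2,X_2))=0$, where $\sigma$ is the second fundamental form and $(X_1,X_2)$ is an orthonormal tangent frame with $X_1^2=-1$, $X_2^2=1$. *)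

(* Defs.v *)
From HB Require Import structures.
From mathcomp Require Import all_boot all_order all_algebra ring.
From mathcomp Require Import all_classical all_reals all_analysis.
Import Order.TTheory GRing.Theory Num.Theory.
Import numFieldNormedType.Exports.

Set Implicit Arguments.
Unset Strict Implicit.
Unset Printing Implicit Defensive.

Local Open Scope classical_set_scope.
Local Open Scope ring_scope.

(* The double number u + j v is the row vector (u, v), from which D takes its
   real vector space structure and its topology. *)
Definition dnum (R : realType) : Type := 'rV[R]_2.

Section DoubleNumbers.
Variable R : realType.

HB.instance Definition _ := NormedModule.copy (dnum R) 'rV[R]_2.

Definition dn (u v : R) : dnum R := \row_(i < 2) (if i == 0 then u else v).
Definition dnre (t : dnum R) : R := t 0 0.
Definition dnim (t : dnum R) : R := t 0 1.

Fact dnreE u v : dnre (dn u v) = u. Proof. by rewrite /dnre mxE. Qed.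
Fact dnimE u v : dnim (dn u v) = v. Proof. by rewrite /dnim mxE. Qed.

Fact dnP (s t : dnum R) : dnre s = dnre t -> dnim s = dnim t -> s = t.
Proof.
move=> h0 h1; apply/rowP => i.
have [->|->] // : i = 0 \/ i = 1.
by case: i => -[|[|//]] ?; [left|right]; apply: val_inj.
Qed.

Fact dnreD (s t : dnum R) : dnre (s + t) = dnre s + dnre t.
Proof. exact: mxE. Qed.
Fact dnimD (s t : dnum R) : dnim (s + t) = dnim s + dnim t.
Proof. exact: mxE. Qed.
Fact dnreN (t : dnum R) : dnre (- t) = - dnre t. Proof. exact: mxE. Qed.
Fact dnimN (t : dnum R) : dnim (- t) = - dnim t. Proof. exact: mxE. Qed.
Fact dnreZ (a : R) (t : dnum R) : dnre (a *: t) = a * dnre t.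
Proof. exact: mxE. Qed.
Fact dnimZ (a : R) (t : dnum R) : dnim (a *: t) = a * dnim t.
Proof. exact: mxE. Qed.

Definition dnconj (t : dnum R) : dnum R := dn (dnre t) (- dnim t).

Definition dnmul (s t : dnum R) : dnum R :=
  dn (dnre s * dnre t + dnim s * dnim t) (dnre s * dnim t + dnim s * dnre t).

Fact dnmulA : associative dnmul.
Proof. by move=> r s t; apply: dnP; rewrite !(dnreE, dnimE); ring. Qed.

Fact dnmulC : commutative dnmul.
Proof. by move=> s t; apply: dnP; rewrite !(dnreE, dnimE); ring. Qed.

Fact dnmul1 : left_id (dn 1 0) dnmul.
Proof. by move=> t; apply: dnP; rewrite !(dnreE, dnimE); ring. Qed.

Fact dnmulDl : left_distributive dnmul +%R.
Proof.
by move=> r s t; apply: dnP; rewrite !(dnreE, dnimE, dnreD, dnimD); ring.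
Qed.

Fact dn1_neq0 : dn 1 0 != 0.
Proof. by apply/eqP => /rowP/(_ 0)/eqP; rewrite !mxE oner_eq0. Qed.

HB.instance Definition _ := GRing.Zmodule_isComNzRing.Build (dnum R)
  dnmulA dnmulC dnmul1 dnmulDl dn1_neq0.

Fact dnreM (s t : dnum R) : dnre (s * t) = dnre s * dnre t + dnim s * dnim t.
Proof. exact: dnreE. Qed.
Fact dnimM (s t : dnum R) : dnim (s * t) = dnre s * dnim t + dnim s * dnre t.
Proof. exact: dnimE. Qed.

Fact dnscaleAl (a : R) (s t : dnum R) : a *: (s * t) = (a *: s) * t.
Proof.
by apply: dnP; rewrite !(dnreM, dnimM, dnreZ, dnimZ); ring.
Qed.

HB.instance Definition _ := GRing.Lmodule_isLalgebra.Build R (dnum R) dnscaleAl.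

Definition dnj : dnum R := dn 0 1.

Fact dnj2 : dnj * dnj = 1.
Proof. by apply: dnP; rewrite !(dnreM, dnimM, dnreE, dnimE); ring. Qed.

End DoubleNumbers.

(* At S = R this is the scalar product of R^4_2; at S = dnum R it is its
   bilinear extension to D^4_2. *)
Definition sprod (S : comNzRingType) (a b : 'rV[S]_4) : S :=
  - (a 0 (inord 0) * b 0 (inord 0)) + a 0 (inord 1) * b 0 (inord 1)
  - a 0 (inord 2) * b 0 (inord 2) + a 0 (inord 3) * b 0 (inord 3).

Section Surfaces.
Variable R : realType.

(* |a|^2 = a . conj a, which is a real double number by [sprod_conj_real]. *)
Definition hnorm2 (a : 'rV[dnum R]_4) : R :=
  dnre (sprod a (map_mx (@dnconj R) a)).

Fact sprod_conj_real (a : 'rV[dnum R]_4) :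
  sprod a (map_mx (@dnconj R) a) = dn (hnorm2 a) 0.
Proof.
apply: dnP; rewrite ?dnreE // dnimE /sprod !mxE.
by rewrite !(dnimD, dnimN, dnimM, dnreE, dnimE); ring.
Qed.

(* All iterated directional derivatives are (Frechet) differentiable on D;
   for open D this is the class C^oo.  Values of f outside D are irrelevant. *)
Definition smooth_on (V W : normedModType R) (D : set V) (f : V -> W) : Prop :=
  forall (vs : seq V) (p : V), D p ->
    differentiable (foldr (fun v g => 'D_v g) f vs) p.

Definition domain (D : set (dnum R)) : Prop := open D /\ connected D.

(* As 1 = dn 1 0 and dnj = dn 0 1, 'D_1 and 'D_(dnj R) are the partial
   derivatives in u and v. *)
Definition d_t (f : dnum R -> dnum R) (t : dnum R) : dnum R :=
  2^-1 *: ('D_1 f t + dnj R * 'D_(dnj R) f t).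

Definition d_tbar (f : dnum R -> dnum R) (t : dnum R) : dnum R :=
  2^-1 *: ('D_1 f t - dnj R * 'D_(dnj R) f t).

Definition holomorphic_on (D : set (dnum R)) (f : dnum R -> dnum R)
    : Prop :=
  smooth_on D f /\ forall t, D t -> d_tbar f t = 0.

Definition vholomorphic_on (D : set (dnum R))
    (Psi : dnum R -> 'rV[dnum R]_4) : Prop :=
  forall i, holomorphic_on D (fun t => Psi t 0 i).

Definition vd_t (Psi : dnum R -> 'rV[dnum R]_4) (t : dnum R)
    : 'rV[dnum R]_4 :=
  \row_i d_t (fun s => Psi s 0 i) t.

Definition vRe (a : 'rV[dnum R]_4) : 'rV[R]_4 := map_mx (@dnre R) a.

Section Pointwise.
Variables (x : dnum R -> 'rV[R]_4) (p : dnum R).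

Definition tangent_plane : set 'rV[R]_4 := range ('d x p).

Definition normal_plane : set 'rV[R]_4 :=
  [set n | forall X, tangent_plane X -> sprod n X = 0].

(* Tangent vectors are represented by their coordinate vectors:
   X1 = 'd x p w1 and X2 = 'd x p w2. *)
Definition orthonormal_frame (w1 w2 : dnum R) : Prop :=
  [/\ sprod ('d x p w1) ('d x p w1) = -1,
      sprod ('d x p w2) ('d x p w2) = 1 &
      sprod ('d x p w1) ('d x p w2) = 0].

(* The component of a in normal_plane along tangent_plane.  It exists and is
   unique when the scalar product is nondegenerate on the tangent plane. *)
Definition normal_part (a : 'rV[R]_4) : 'rV[R]_4 :=
  xget 0 [set n | normal_plane n /\ tangent_plane (a - n)].

(* Gauss formula: sigma(X, Y) is the normal part of the derivative along X of
   a tangent field extending Y; for X = 'd x p w1 and Y = 'd x p w2 the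
   extension used is the field q |-> 'd x q w2 = 'D_w2 x q. *)
Definition second_form (w1 w2 : dnum R) : 'rV[R]_4 :=
  normal_part ('D_w1 ('D_w2 x) p).

Definition mean_curvature (w1 w2 : dnum R) : 'rV[R]_4 :=
  2^-1 *: (- second_form w1 w1 + second_form w2 w2).

End Pointwise.

Definition immersion_on (D : set (dnum R)) (x : dnum R -> 'rV[R]_4)
    : Prop :=
  smooth_on D x /\ forall p, D p -> injective ('d x p).

(* The existence of an orthonormal frame with X1^2 = -1 and X2^2 = 1 in a plane
   says that its scalar product has signature (1, 1). *)
Definition timelike_surface (D : set (dnum R)) (x : dnum R -> 'rV[R]_4)
    : Prop :=
  [/\ domain D, immersion_on D x &
      forall p, D p -> exists w1 w2, orthonormal_frame x p w1 w2].

Definition minimal (D : set (dnum R)) (x : dnum R -> 'rV[R]_4) : Prop :=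
  forall p w1 w2, D p ->
    orthonormal_frame x p w1 w2 -> mean_curvature x p w1 w2 = 0.

Definition isothermal (D : set (dnum R)) (x : dnum R -> 'rV[R]_4) : Prop :=
  forall p, D p ->
    let xu := 'D_1 x p in let xv := 'D_(dnj R) x p in
    [/\ sprod xu xu = - sprod xv xv, sprod xu xv = 0 & sprod xu xu < 0].

End Surfaces.

(* Main.v *)
Require Import Defs.
From HB Require Import structures.
From mathcomp Require Import all_boot all_order all_algebra ring lra.
From mathcomp Require Import all_classical all_reals all_analysis.
Import Order.TTheory GRing.Theory Num.Theory.
Import numFieldNormedType.Exports.
Local Open Scope classical_set_scope.
Local Open Scope ring_scope.

(** In isothermal coordinates with E = x_u . x_u, differentiating
    x_u . x_u + x_v . x_v = 0 and x_u . x_v = 0 shows that x_vv - x_uu is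
    orthogonal to x_u and x_v ([isothermal_dalembertian_normal]).  Minimality
    says that the same vector is tangent, and the scalar product is
    nondegenerate on the tangent plane; so a surface in isothermal coordinates
    is minimal exactly when x_uu = x_vv ([minimal_wave], [wave_minimal]).  The
    mean curvature is required to vanish for every orthonormal frame, not only
    for the one proportional to (x_u, x_v); but in the coordinates (u, v) an
    orthonormal frame is (a, b), +-(b, a) ([orthonormal_frame_flip]), and
    for such a pair the two second derivatives of a solution of the wave
    equation agree.

    If Psi is holomorphic and x = Re Psi, the Cauchy-Riemann equations
    Psi_u = j Psi_v give Psi' = x_u + j x_v ([vd_t_vRe]) and
    Psi_uu = j^2 Psi_vv = Psi_vv ([holomorphic_wave]).  Moreover
    Psi'^2 = (x_u^2 + x_v^2) + 2 j (x_u . x_v) and |Psi'|^2 = x_u^2 - x_v^2,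
    so the two conditions on Psi are precisely isothermality of x with E < 0
    ([isothermal_vd_t]).  This already gives the converse part.

    For the direct part it remains to see that a solution x of the wave
    equation is locally the real part of a holomorphic map.  The idempotents
    e = (1 + j)/2 and e' = (1 - j)/2 split the plane into two null directions,
    and the wave equation is the vanishing of the mixed derivative along them;
    so, near p, d'Alembert's formula
      x(t) = x(p + e (t - p)) + x(p + e' (t - p)) - x(p)
    holds ([wave_lift_vRe]).  A function of e t alone becomes holomorphic after
    multiplication by e, because j e = e, and a function of e' t alone after
    multiplication by e', because j e' = - e'.  Hence
      Psi(t) = 2 x(p + e (t - p)) e + 2 x(p + e' (t - p)) e' - x(p)
    is holomorphic ([wave_lift_holomorphic]), with real part x.

    The analytic input is the symmetry of second derivatives ([schwarz]) and
    the stability of the class of smooth maps under composition with linear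
    and affine maps. *)

Set Implicit Arguments.
Unset Strict Implicit.
Unset Printing Implicit Defensive.

(** * Smooth maps and directional derivatives *)

Section Local.
Variables (R : realType) (V W : normedModType R).

(** [differentiable] speaks of the chosen differential of the map, so the
    differential of [f] has to be recognised as that of [g]. *)
Lemma near_eq_differentiable (f g : V -> W) p :
  (\near p, f p = g p) -> differentiable f p -> differentiable g p.
Proof.
move=> fg df.
have [dc de] := (diff_locallyP p f).1 df.
have e : g \o shift p = cst (g p) + 'd f p +o_ 0 id.
  apply/eqaddoP => /= eps eps0.
  have /eqaddoP/(_ eps eps0) H := de.
  have H2 : \forall x \near (0:V), f (x + p) = g (x + p).
    have := fg; rewrite (near_shift 0) /= => fg'.
    by apply: filterS fg' => x /=; rewrite subr0.
  apply: filterS2 H H2 => x; rewrite -!fctE /=.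
  by rewrite /cst /= !fctE /= => + <-; rewrite (nbhs_singleton fg).
apply/diff_locallyP.
by rewrite (diff_unique dc e).
Qed.

Lemma open_eq_derive (D : set V) (f g : V -> W) v p : open D ->
  {in D, f =1 g} -> D p -> 'D_v f p = 'D_v g p.
Proof.
move=> Do fg Dp; apply: near_eq_derive.
have : nbhs p D by exact: open_nbhs_nbhs.
by apply: filterS => q Dq; apply: fg; rewrite inE.
Qed.

Lemma deriveDl (f : V -> W) v w p : differentiable f p ->
  'D_(v + w) f p = 'D_v f p + 'D_w f p.
Proof. by move=> df; rewrite !deriveE // linearD. Qed.

Lemma deriveZl (f : V -> W) c v p : differentiable f p ->
  'D_(c *: v) f p = c *: 'D_v f p.
Proof. by move=> df; rewrite !deriveE // linearZ. Qed.

Lemma smooth_on_differentiable (D : set V) (f : V -> W) p :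
  smooth_on D f -> D p -> differentiable f p.
Proof. by move=> sf; apply: (sf [::]). Qed.

Lemma smooth_on_derive (D : set V) (f : V -> W) v :
  smooth_on D f -> smooth_on D ('D_v f).
Proof.
by move=> sf vs p Dp; have := sf (rcons vs v) p Dp; rewrite foldr_rcons.
Qed.

(** Smoothness of a map obtained by an operation from smooth maps follows from
    differentiability as soon as the class of all such maps is stable under
    directional derivatives. *)
Lemma smooth_on_coind (D : set V) (C : set (V -> W)) :
  (forall f, C f -> (forall p, D p -> differentiable f p) /\
     forall v, C ('D_v f)) ->
  forall f, C f -> smooth_on D f.
Proof.
move=> H f Cf vs; elim/last_ind: vs f Cf => [|vs v IH] f Cf p Dp.
  exact: (H _ Cf).1.
by rewrite foldr_rcons; apply: IH => //; apply: (H _ Cf).2.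
Qed.

End Local.

(** * Mean value formulas and symmetry of second derivatives *)

Section MeanValue.
Variables (R : realType) (V : normedModType R).

Lemma derivable_line (f : V -> R) (p v : V) (s : R) :
  differentiable f (p + s *: v) ->
  is_derive s 1 (fun s : R => f (p + s *: v)) ('D_v f (p + s *: v)).
Proof.
move=> df.
have dg : is_diff s (fun s : R => p + s *: v) ( *:%R^~ v).
  by apply: is_diff_eq; rewrite add0r.
have := @is_diff_comp _ _ _ _ _ _ _ _ _ dg (differentiableP df).
move=> [d1 d2]; apply: DeriveDef; first exact: diff_derivable.
by rewrite deriveE // d2 /= scale1r deriveE.
Qed.

Lemma mean_value_segment (f : V -> R) (p v : V) :
  (forall s : R, 0 <= s <= 1 -> differentiable f (p + s *: v)) ->
  exists2 c : R, 0 <= c <= 1 & f (p + v) - f p = 'D_v f (p + c *: v).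
Proof.
move=> df.
have dr (s : R) : 0 <= s <= 1 ->
    is_derive s 1 (fun s : R => f (p + s *: v)) ('D_v f (p + s *: v)).
  by move=> /df; exact: derivable_line.
have [||c c01] := @MVT_segment R (fun s => f (p + s *: v))
    (fun s => 'D_v f (p + s *: v)) 0 1 ler01.
- by move=> x; rewrite in_itv /= => /andP[x0 x1]; apply: dr; rewrite !ltW.
- apply: derivable_within_continuous => x /[!in_itv] /= x01.
  by have [] := dr _ x01.
- rewrite scale1r scale0r addr0 subr0 mulr1 => e; exists c => //.
Qed.

Lemma derive_translate (W : normedModType R) (f : V -> W) (w p v : V) :
  'D_v (fun q => f (q + w)) p = 'D_v f (p + w).
Proof. by rewrite /derive; under eq_fun do rewrite /= -addrA. Qed.

Lemma differentiable_translate (W : normedModType R) (f : V -> W) (w p : V) :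
  differentiable f (p + w) -> differentiable (fun q => f (q + w)) p.
Proof.
by move=> df; apply: (@differentiable_comp _ _ _ _ (fun q => q + w)).
Qed.

Lemma deriveZl_real (f : V -> R) c v p : differentiable f p ->
  'D_(c *: v) f p = c * 'D_v f p.
Proof. exact: deriveZl. Qed.

(** The mean value theorem for [fun q => f (q + w) - f q]; both the symmetry of
    second derivatives and d'Alembert's formula start from it. *)
Lemma mean_value_square (f : V -> R) (p v w : V) :
  (forall s : R, 0 <= s <= 1 -> differentiable f (p + s *: v)) ->
  (forall s : R, 0 <= s <= 1 -> differentiable f (p + s *: v + w)) ->
  exists2 c : R, 0 <= c <= 1 &
    f (p + v + w) - f (p + v) - f (p + w) + f p =
    'D_v f (p + c *: v + w) - 'D_v f (p + c *: v).
Proof.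
move=> d1 d2.
pose g q := f (q + w) - f q.
have dt s : 0 <= s <= 1 -> differentiable (fun q => f (q + w)) (p + s *: v).
  by move=> s01; apply: differentiable_translate; exact: d2.
have [s s01|c c01 e] := @mean_value_segment g p v.
  by apply: differentiableB; [exact: dt|exact: d1].
exists c => //.
rewrite (_ : _ + f p = g (p + v) - g p); last by rewrite /g; ring.
rewrite e deriveB; last 2 first.
- exact/diff_derivable/dt.
- exact/diff_derivable/d1.
by rewrite derive_translate.
Qed.

(** The second difference quotient converges to the iterated derivative:
    by [mean_value_square] the second difference is [h] times a difference of
    values of ['D_v f] at two points at distance O(h) of [p], and ['D_v f] is
    differentiable at [p]. *)
Lemma second_difference (f : V -> R) (p v w : V) :
  (\near p, differentiable f p) -> differentiable ('D_v f) p ->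
  forall eps : R, 0 < eps -> exists2 d : R, 0 < d & forall h : R, `|h| < d ->
  `|f (p + h *: v + h *: w) - f (p + h *: v) - f (p + h *: w) + f p
    - h ^+ 2 * 'D_w ('D_v f) p| <= eps * h ^+ 2.
Proof.
move=> df dg eps eps0.
(* M bounds s v + t w for s and t in [0, 1]; the added 1 keeps it positive. *)
pose M := `|v| + `|w| + 1.
have M0 : 0 < M by rewrite /M ltr_wpDl.
pose e := eps / (2 * M).
have e0 : 0 < e by rewrite divr_gt0 // mulr_gt0.
have [_ /eqaddoP/(_ _ e0)] := (diff_locallyP p _).1 dg.
move=> /nbhs_ballP[d1 /= d10 H1].
have /nbhs_ballP[d2 /= d20 H2] := df.
exists (Num.min d1 d2 / M); first by rewrite divr_gt0 // lt_min d10.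
move=> h; rewrite ltr_pdivlMr // lt_min => /andP[hd1 hd2].
have kb (s t : R) : 0 <= s <= 1 -> 0 <= t <= 1 ->
    `|s *: (h *: v) + t *: (h *: w)| <= `|h| * M.
  move=> /andP[s0 s1] /andP[t0 t1]; rewrite (le_trans (ler_normD _ _)) //.
  rewrite !normrZ (ger0_norm s0) (ger0_norm t0) !(mulrCA _ `|h|) -mulrDr.
  rewrite ler_wpM2l // /M -addrA lerD ?ler_piMl // ler_wpDr //.
  by rewrite ler_piMl.
have dfk (s t : R) : 0 <= s <= 1 -> 0 <= t <= 1 ->
    differentiable f (p + (s *: (h *: v) + t *: (h *: w))).
  move=> s01 t01; apply: H2; rewrite -ball_normE /ball_ /= opprD addrA subrr.
  by rewrite sub0r normrN (le_lt_trans (kb _ _ s01 t01)).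
have i0 : 0 <= (0 : R) <= 1 by rewrite lexx ler01.
have i1 : 0 <= (1 : R) <= 1 by rewrite lexx ler01.
have [s s01|s s01|c c01 ->] := @mean_value_square f p (h *: v) (h *: w).
- by have := dfk s 0 s01 i0; rewrite scale0r addr0.
- by have := dfk s 1 s01 i1; rewrite scale1r addrA.
rewrite !deriveZl_real; last 2 first.
- by have := dfk c 0 c01 i0; rewrite scale0r addr0.
- by have := dfk c 1 c01 i1; rewrite scale1r addrA.
have gk (s t : R) : 0 <= s <= 1 -> 0 <= t <= 1 ->
   `|'D_v f (p + (s *: (h *: v) + t *: (h *: w))) -
     ('D_v f p + 'd ('D_v f) p (s *: (h *: v) + t *: (h *: w)))|
   <= e * (`|h| * M).
  move=> s01 t01.
  have /H1 : ball (0 : V) d1 (s *: (h *: v) + t *: (h *: w)).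
    rewrite -ball_normE /ball_ /= sub0r normrN.
    by rewrite (le_lt_trans (kb _ _ s01 t01)).
  rewrite /= !fctE /cst /= [_ + p]addrC => /le_trans; apply.
  by rewrite ler_wpM2l ?kb // ltW.
have := gk c 1 c01 i1; have := gk c 0 c01 i0.
rewrite scale0r scale1r addr0 addrA => g0 g1.
rewrite (deriveE w dg).
have L0 : 'd ('D_v f) p (c *: (h *: v)) = c * (h * 'd ('D_v f) p v).
  by rewrite 2!linearZ.
have L1 : 'd ('D_v f) p (c *: (h *: v) + h *: w) =
    c * (h * 'd ('D_v f) p v) + h * 'd ('D_v f) p w.
  by rewrite linearD L0 linearZ.
move: g0 g1; rewrite L0 L1.
set g0 := 'D_v f (p + c *: _); set g1 := 'D_v f (_ + h *: w).
set a := 'D_v f p; set b := 'd _ _ v; set b' := 'd _ _ w.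
move=> e1 e2.
rewrite (_ : _ - _ = h * ((g1 - (a + (c * (h * b) + h * b')))
  - (g0 - (a + c * (h * b))))); last first.
by ring.
rewrite normrM (le_trans (ler_wpM2l _ (ler_normB _ _))) //.
rewrite (le_trans (ler_wpM2l _ (lerD e2 e1))) //.
rewrite -(real_normK (num_real h)) /e le_eqVlt; apply/orP; left; apply/eqP.
by field; rewrite gt_eqF.
Qed.

(** The second difference is symmetric in [v] and [w], while
    [second_difference] identifies its limit with either iterated derivative. *)
Lemma schwarz_real (f : V -> R) (p v w : V) :
  (\near p, differentiable f p) ->
  differentiable ('D_v f) p -> differentiable ('D_w f) p ->
  'D_w ('D_v f) p = 'D_v ('D_w f) p.
Proof.
move=> df dv dw; apply/eqP; rewrite -subr_eq0 -normr_le0.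
apply/ler_addgt0Pl => e e0; rewrite addr0.
have e20 : 0 < e / 2 by rewrite divr_gt0.
have [d1 d10 H1] := second_difference w df dv e20.
have [d2 d20 H2] := second_difference v df dw e20.
pose h := Num.min d1 d2 / 2.
have h0 : 0 < h by rewrite divr_gt0 // lt_min d10.
have hd : h < Num.min d1 d2.
  by rewrite ltr_pdivrMr // ltr_pMr ?lt_min ?d10 // ltr1n.
move: hd; rewrite lt_min => /andP[hd1 hd2].
have := H2 h; have := H1 h.
rewrite (gtr0_norm h0) => /(_ hd1) {}H1 /(_ hd2) {}H2.
have h20 : 0 < h ^+ 2 by rewrite exprn_gt0.
rewrite -(ler_pM2r h20) -[X in _ * X <= _](gtr0_norm h20) -normrM.
move: H1 H2; rewrite (addrAC p (h *: w)).
set F := f _; set A := 'D_w _ _; set B := 'D_v _ _.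
set G := f _; set H := f _; set I := f _ => H1 H2.
rewrite (_ : (A - B) * _ = (F - H - G + I - h ^+ 2 * B)
  - (F - G - H + I - h ^+ 2 * A)); last by ring.
rewrite (le_trans (ler_normB _ _)) //.
rewrite (le_trans (lerD H2 H1)) // -mulrDl.
by rewrite -splitr.
Qed.

End MeanValue.

(** * Operations on smooth maps *)

Section Closure.
Variables (R : realType).

Section Comp.
Variables (U V W W' : normedModType R) (L : U -> V) (l : U -> V).
Variable (A : {linear W -> W'}).
Hypothesis Ac : continuous A.
Hypothesis dL : forall t, differentiable L t.
Hypothesis DL : forall t v, 'D_v L t = l v.

Lemma differentiable_affine_linear (f : V -> W) t :
  differentiable f (L t) -> differentiable (fun t => A (f (L t))) t.
Proof.
move=> df; apply: (@differentiable_comp _ _ _ _ (f \o L) A).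
  exact: differentiable_comp.
exact: linear_differentiable.
Qed.

Lemma derive_affine_linear (f : V -> W) v t : differentiable f (L t) ->
  'D_v (fun t => A (f (L t))) t = A ('D_(l v) f (L t)).
Proof.
move=> df; rewrite deriveE; last exact: differentiable_affine_linear.
rewrite (@diff_comp _ _ _ _ (f \o L) A) /=.
- rewrite diff_lin //; congr (A _).
  by rewrite diff_comp //= deriveE // -(DL t) deriveE.
- exact: differentiable_comp.
- exact: linear_differentiable.
Qed.

(** When [L] has constant directional derivatives, a derivative of
    [A \o f \o L] has again the form [A \o g \o L], with [g] a derivative of
    [f]. *)
Lemma smooth_on_affine_linear (E : set U) (D : set V) (f : V -> W) :
  open E -> (forall t, E t -> D (L t)) -> smooth_on D f ->
  smooth_on E (fun t => A (f (L t))).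
Proof.
move=> Eo ED sf.
pose C : set (U -> W') := [set h | exists2 g, smooth_on D g &
  forall t, E t -> h t = A (g (L t))].
apply: (@smooth_on_coind _ _ _ E C); last by exists f.
move=> h [g sg hg].
have dg t : E t -> differentiable g (L t).
  by move=> /ED; exact: smooth_on_differentiable.
split=> [p Ep|v].
  apply: (@near_eq_differentiable _ _ _ (fun t => A (g (L t)))).
    have : nbhs p E by exact: open_nbhs_nbhs.
    by apply: filterS => q /hg.
  exact/differentiable_affine_linear/dg.
exists ('D_(l v) g); first exact: smooth_on_derive.
move=> t Et; rewrite -derive_affine_linear; last exact: dg.
by apply: (@open_eq_derive _ _ _ E) => // s /[!inE]/hg.
Qed.

End Comp.

Lemma smooth_onD (V W : normedModType R) (E : set V) (f g : V -> W) :
  open E -> smooth_on E f -> smooth_on E g -> smooth_on E (fun t => f t + g t).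
Proof.
move=> Eo sf sg.
pose C : set (V -> W) := [set h | exists f g, [/\ smooth_on E f, smooth_on E g &
  forall t, E t -> h t = f t + g t]].
apply: (@smooth_on_coind _ _ _ E C); last by exists f, g.
move=> {sf sg f g} h [f [g [sf sg hfg]]]; split=> [p Ep|v].
  apply: (@near_eq_differentiable _ _ _ (f + g)).
    have : nbhs p E by exact: open_nbhs_nbhs.
    by apply: filterS => q /hfg ->.
  apply: differentiableD.
  - exact: (smooth_on_differentiable sf Ep).
  - exact: (smooth_on_differentiable sg Ep).
exists ('D_v f), ('D_v g).
split=> [||t Et]; [exact: smooth_on_derive|exact: smooth_on_derive|].
rewrite -deriveD; last 2 first.
- exact: (diff_derivable (smooth_on_differentiable sf Et)).
- exact: (diff_derivable (smooth_on_differentiable sg Et)).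
by apply: (@open_eq_derive _ _ _ E) => // s /[!inE]/hfg.
Qed.

Lemma smooth_on_cst (V W : normedModType R) (E : set V) (c : W) :
  smooth_on E (cst c).
Proof.
apply: (@smooth_on_coind _ _ _ E [set h | exists c, h = cst c]).
  2: by exists c.
move=> _ [d ->]; split=> // v; exists 0; apply/funext => p.
by rewrite derive_cst.
Qed.

Lemma smooth_on_sum (V W : normedModType R) I (r : seq I) (D : set V)
    (F : I -> V -> W) :
  open D -> (forall i, smooth_on D (F i)) ->
  smooth_on D (fun q => \sum_(i <- r) F i q).
Proof.
move=> Do sF; elim: r => [|i r IH].
  rewrite (_ : (fun _ => _) = cst 0); first exact: smooth_on_cst.
  by apply/funext => t; rewrite big_nil.
rewrite (_ : (fun _ => _) = fun q : V => F i q + \sum_(i <- r) F i q).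
  exact: smooth_onD.
by apply/funext => t; rewrite big_cons.
Qed.

Section Coord.
Variables (n : nat) (W : normedModType R) (i : 'I_n) (c : W).

(** Real parts, components and multiplication by a double number are all sums
    of such maps, which makes their continuity evident. *)
Definition coordZ (w : 'rV[R]_n) : W := w 0 i *: c.

Lemma coordZ_is_linear : linear coordZ.
Proof. by move=> a u v; rewrite /coordZ !mxE scalerDl scalerA. Qed.

HB.instance Definition _ :=
  GRing.isLinear.Build R 'rV[R]_n W *:%R coordZ coordZ_is_linear.

Lemma coordZ_continuous : continuous coordZ.
Proof.
move=> w; apply: differentiable_continuous.
by apply: differentiableZl; exact: differentiable_coord.
Qed.

End Coord.

Lemma derive_coord (V : normedModType R) n (f : V -> 'rV[R]_n) v p i :
  differentiable f p -> ('D_v f p) 0 i = 'D_v (fun t => f t 0 i) p.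
Proof. by move=> df; rewrite derive_mx ?mxE //; exact: diff_derivable. Qed.

Lemma differentiable_coord_comp (V : normedModType R) n
    (f : V -> 'rV[R]_n) p i :
  differentiable f p -> differentiable (fun t => f t 0 i) p.
Proof.
move=> df.
apply: (@differentiable_comp _ _ _ _ f (fun w : 'rV[R]_n => w 0 i)) => //.
exact: differentiable_coord.
Qed.

Lemma smooth_on_coord (V : normedModType R) n (D : set V)
    (f : V -> 'rV[R]_n) i :
  open D -> smooth_on D f -> smooth_on D (fun t => f t 0 i).
Proof.
move=> Do sf; rewrite (_ : (fun t => _) = fun t => coordZ i (1 : R) (f t)).
  apply: (@smooth_on_affine_linear V V 'rV[R]_n R id id (coordZ i (1 : R))
    _ _ _ D D f) => //.
  - exact: coordZ_continuous.
  - by move=> s v; rewrite derive_id.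
by apply/funext => t; rewrite /coordZ [RHS]mulr1.
Qed.

Lemma derive2_coord (V : normedModType R) n (D : set V)
    (f : V -> 'rV[R]_n) v w p i :
  open D -> smooth_on D f -> D p ->
  'D_w ('D_v f) p 0 i = 'D_w ('D_v (fun t => f t 0 i)) p.
Proof.
move=> Do sf Dp.
have dv := smooth_on_differentiable (smooth_on_derive v sf) Dp.
apply: (etrans (derive_coord w i dv)).
apply: (open_eq_derive w Do) => // q /[!inE] Dq.
exact: (derive_coord v i (smooth_on_differentiable sf Dq)).
Qed.

Lemma schwarz_smooth (V : normedModType R) (D : set V) (f : V -> R) v w p :
  open D -> smooth_on D f -> D p -> 'D_w ('D_v f) p = 'D_v ('D_w f) p.
Proof.
move=> Do sf Dp; apply: schwarz_real.
- have : nbhs p D by exact: open_nbhs_nbhs.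
  by apply: filterS => q Dq; exact: (smooth_on_differentiable sf Dq).
- exact: (smooth_on_differentiable (smooth_on_derive v sf) Dp).
- exact: (smooth_on_differentiable (smooth_on_derive w sf) Dp).
Qed.

Lemma schwarz (V : normedModType R) n (D : set V) (f : V -> 'rV[R]_n) v w p :
  open D -> smooth_on D f -> D p -> 'D_w ('D_v f) p = 'D_v ('D_w f) p.
Proof.
move=> Do sf Dp; apply/rowP => i.
apply: (etrans (derive2_coord v w i Do sf Dp)).
apply: (etrans _ (esym (derive2_coord w v i Do sf Dp))).
exact: (schwarz_smooth _ _ Do (smooth_on_coord i Do sf) Dp).
Qed.

Lemma second_derive_lin (V W : normedModType R) (D : set V) (f : V -> W)
    (a b a' b' : R) v w z z' p :
  open D -> smooth_on D f -> D p ->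
  z = a *: v + b *: w -> z' = a' *: v + b' *: w ->
  'D_z' ('D_z f) p =
  (a' * a) *: 'D_v ('D_v f) p + (a' * b) *: 'D_v ('D_w f) p
  + (b' * a) *: 'D_w ('D_v f) p + (b' * b) *: 'D_w ('D_w f) p.
Proof.
move=> Do sf Dp -> ->.
have df q : D q -> differentiable f q by exact: smooth_on_differentiable.
have ddf u : differentiable ('D_u f) p.
  exact: (smooth_on_differentiable (smooth_on_derive u sf) Dp).
have F (c d : R) g q : differentiable g q ->
    'D_(c *: v + d *: w) g q = c *: 'D_v g q + d *: 'D_w g q.
  by move=> dg; rewrite (deriveDl _ _ dg) (deriveZl _ _ dg) (deriveZl _ _ dg).
have E u : 'D_u ('D_(a *: v + b *: w) f) p =
    a *: 'D_u ('D_v f) p + b *: 'D_u ('D_w f) p.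
  have dv := diff_derivable (v := u) (ddf v).
  have dw := diff_derivable (v := u) (ddf w).
  rewrite -(deriveZ a dv) -(deriveZ b dw).
  rewrite -(deriveD (derivableZ dv) (derivableZ dw)).
  apply: (@open_eq_derive _ _ _ D) => // q /[!inE] Dq.
  exact: F (df _ Dq).
rewrite E (F _ _ _ _ _ (ddf v)) (F _ _ _ _ _ (ddf w)).
move: ('D_v ('D_v f) p) ('D_w ('D_v f) p) ('D_v ('D_w f) p) ('D_w ('D_w f) p).
move=> vv vw wv ww; rewrite !scalerDr !scalerA !(mulrC _ a') !(mulrC _ b').
by rewrite addrACA !addrA.
Qed.

Lemma second_deriveZ (V W : normedModType R) (D : set V) (f : V -> W)
    (c : R) v p :
  open D -> smooth_on D f -> D p ->
  'D_(c *: v) ('D_(c *: v) f) p = (c * c) *: 'D_v ('D_v f) p.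
Proof.
move=> Do sf Dp; have e : c *: v = c *: v + 0 *: 0 by rewrite scaler0 addr0.
apply: (etrans (second_derive_lin Do sf Dp e e)).
move: ('D_v ('D_v f) p) ('D_0 ('D_v f) p) ('D_v ('D_0 f) p).
move: ('D_0 ('D_0 f) p) => A B B' A'.
by rewrite !mulr0 !mul0r !scale0r !addr0.
Qed.

End Closure.

(** * Calculus on the double numbers *)

Section Dnum.
Variables (R : realType).
Implicit Types (w t : dnum R).

Lemma dn1re : dnre (1 : dnum R) = 1. Proof. exact: dnreE. Qed.
Lemma dn1im : dnim (1 : dnum R) = 0. Proof. exact: dnimE. Qed.
Lemma dnjre : dnre (dnj R) = 0. Proof. exact: dnreE. Qed.
Lemma dnjim : dnim (dnj R) = 1. Proof. exact: dnimE. Qed.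
Lemma dn0re : dnre (0 : dnum R) = 0. Proof. exact: mxE. Qed.
Lemma dn0im : dnim (0 : dnum R) = 0. Proof. exact: mxE. Qed.

Definition dnE := (dn1re, dn1im, dnjre, dnjim, dn0re, dn0im, dnreE, dnimE,
  dnreD, dnimD, dnreN, dnimN, dnreZ, dnimZ, dnreM, dnimM).

Lemma dnum_basis w : w = dnre w *: 1 + dnim w *: dnj R.
Proof. by apply: dnP; rewrite !dnE; ring. Qed.

Lemma derive_dn (W : normedModType R) (f : dnum R -> W) w p :
  differentiable f p ->
  'D_w f p = dnre w *: 'D_1 f p + dnim w *: 'D_(dnj R) f p.
Proof.
move=> df; rewrite {1}(dnum_basis w) (deriveDl _ _ df).
by rewrite (deriveZl _ _ df) (deriveZl _ _ df).
Qed.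

Definition dnmull (e t : dnum R) : dnum R := e * t.

Lemma dnmull_is_linear e : linear (dnmull e).
Proof. by move=> a u v; apply: dnP; rewrite /dnmull !dnE; ring. Qed.

HB.instance Definition _ e :=
  GRing.isLinear.Build R (dnum R) (dnum R) *:%R (dnmull e) (dnmull_is_linear e).

Lemma differentiable_dnmull e t : differentiable (dnmull e) t.
Proof.
rewrite (_ : dnmull e = coordZ 0 e + coordZ 1 (e * dnj R)); last first.
  apply/funext => s; apply: dnP;
    by rewrite /dnmull /coordZ !fctE !dnE /dnre /dnim; ring.
apply: differentiableD; apply: linear_differentiable; exact: coordZ_continuous.
Qed.

Lemma dnmull_continuous e : continuous (dnmull e).
Proof. by move=> t; exact/differentiable_continuous/differentiable_dnmull. Qed.

Lemma derive_dnmull e (f : dnum R -> dnum R) w t : differentiable f t ->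
  'D_w (fun t => e * f t) t = e * 'D_w f t.
Proof.
move=> df; apply: (@derive_affine_linear R _ _ _ _ id id (dnmull e)) => //.
- exact: dnmull_continuous.
- by move=> s v; rewrite derive_id.
Qed.

Lemma derive_dnre (f : dnum R -> dnum R) w t : differentiable f t ->
  'D_w (fun t => dnre (f t)) t = dnre ('D_w f t).
Proof. by move=> df; rewrite /dnre (derive_coord w 0 df). Qed.

Lemma smooth_dnre (D : set (dnum R)) (W : normedModType R)
    (f : dnum R -> dnum R) (c : W) :
  open D -> smooth_on D f -> smooth_on D (fun t => dnre (f t) *: c).
Proof.
move=> Do sf; apply: (@smooth_on_affine_linear R (dnum R) (dnum R) 'rV[R]_2 W
  id id (coordZ 0 c) _ _ _ D D f) => //.
- exact: coordZ_continuous.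
- by move=> s v; rewrite derive_id.
Qed.

Lemma smooth_vRe (D : set (dnum R)) (Psi : dnum R -> 'rV[dnum R]_4) : open D ->
  (forall i, smooth_on D (fun t => Psi t 0 i)) ->
  smooth_on D (fun t => vRe (Psi t)).
Proof.
move=> Do sP.
rewrite (_ : (fun t => _) =
  fun t => \sum_i dnre (Psi t 0 i) *: (delta_mx 0 i : 'rV[R]_4)).
  by apply: smooth_on_sum => // i; exact: smooth_dnre.
apply/funext => t; rewrite [LHS]row_sum_delta.
by apply: eq_bigr => i _; rewrite mxE.
Qed.

Lemma derive_vRe (D : set (dnum R)) (Psi : dnum R -> 'rV[dnum R]_4) w t i :
  open D -> (forall i, smooth_on D (fun t => Psi t 0 i)) -> D t ->
  'D_w (fun t => vRe (Psi t)) t 0 i = dnre ('D_w (fun t => Psi t 0 i) t).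
Proof.
move=> Do sP Dt.
rewrite (derive_coord w i (smooth_on_differentiable (smooth_vRe Do sP) Dt)).
rewrite -(derive_dnre w (smooth_on_differentiable (sP i) Dt)).
by congr ('D_w _ t); apply/funext => s; rewrite mxE.
Qed.

End Dnum.

(** * The scalar product and holomorphic maps *)

Section Geometry.
Variables (R : realType).

Lemma sprodC (a b : 'rV[R]_4) : sprod a b = sprod b a.
Proof. by rewrite /sprod; ring. Qed.

Lemma sprodDl (a b c : 'rV[R]_4) : sprod (a + b) c = sprod a c + sprod b c.
Proof. by rewrite /sprod !mxE; ring. Qed.

Lemma sprodZl k (a b : 'rV[R]_4) : sprod (k *: a) b = k * sprod a b.
Proof. by rewrite /sprod !mxE; ring. Qed.

Lemma sprodBl (a b c : 'rV[R]_4) : sprod (a - b) c = sprod a c - sprod b c.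
Proof. by rewrite /sprod !mxE; ring. Qed.

Lemma sprodDr (a b c : 'rV[R]_4) : sprod a (b + c) = sprod a b + sprod a c.
Proof. by rewrite /sprod !mxE; ring. Qed.

Lemma sprodZr k (a b : 'rV[R]_4) : sprod a (k *: b) = k * sprod a b.
Proof. by rewrite /sprod !mxE; ring. Qed.

Lemma differentiable_sprod (V : normedModType R) (f g : V -> 'rV[R]_4) (p : V) :
  differentiable f p -> differentiable g p ->
  differentiable (fun q => sprod (f q) (g q)) p.
Proof.
move=> df dg.
have d i : differentiable (fun q => f q 0 i * g q 0 i) p.
  by apply: differentiableM; exact: differentiable_coord_comp.
apply: differentiableD (d _); apply: differentiableB (d _).
by apply: differentiableD (d _); apply: differentiableN.
Qed.

Lemma derive_sprod (V : normedModType R) (f g : V -> 'rV[R]_4) (v p : V) :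
  differentiable f p -> differentiable g p ->
  'D_v (fun q => sprod (f q) (g q)) p =
  sprod ('D_v f p) (g p) + sprod (f p) ('D_v g p).
Proof.
move=> df dg.
have df' i : is_derive p v (fun q => f q 0 i) ('D_v f p 0 i).
  rewrite (derive_coord v i df).
  exact/derivableP/diff_derivable/differentiable_coord_comp.
have dg' i : is_derive p v (fun q => g q 0 i) ('D_v g p 0 i).
  rewrite (derive_coord v i dg).
  exact/derivableP/diff_derivable/differentiable_coord_comp.
have dp i := is_deriveM (df' i) (dg' i).
have H := is_deriveD (is_deriveB (is_deriveD (is_deriveN (dp (inord 0)))
  (dp (inord 1))) (dp (inord 2))) (dp (inord 3)).
apply: etrans (@derive_val _ _ _ _ _ _ _ H) _.
move: ('D_v f p) ('D_v g p) (f p) (g p) => f' g' a b.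
by rewrite /sprod /GRing.scale /=; ring.
Qed.

(** Together with [hnorm2_dn], this computes Psi'^2 and |Psi'|^2 for
    Psi' = a + j b. *)
Lemma sprod_dn (a b : 'rV[R]_4) (c := \row_i dn (a 0 i) (b 0 i)) :
  sprod c c = dn (sprod a a + sprod b b) (2 * sprod a b).
Proof. by apply: dnP; rewrite /sprod !mxE !dnE; ring. Qed.

Lemma hnorm2_dn (a b : 'rV[R]_4) :
  hnorm2 (\row_i dn (a 0 i) (b 0 i)) = sprod a a - sprod b b.
Proof. by rewrite /hnorm2 /sprod !mxE !dnE; ring. Qed.

Lemma derive_sprod_sqr_opp (V : normedModType R) (D : set V)
    (f g : V -> 'rV[R]_4) (v p : V) :
  open D -> D p -> differentiable f p -> differentiable g p ->
  (forall q, D q -> sprod (f q) (f q) = - sprod (g q) (g q)) ->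
  sprod ('D_v f p) (f p) = - sprod ('D_v g p) (g p).
Proof.
move=> Do Dp df dg fg.
have : 'D_v (fun q => sprod (f q) (f q)) p
     = 'D_v (- (fun q => sprod (g q) (g q))) p.
  by apply: (open_eq_derive v Do) => // q /[!inE]; exact: fg.
rewrite (deriveN (diff_derivable (differentiable_sprod dg dg))).
rewrite (derive_sprod v df df) (derive_sprod v dg dg).
by rewrite (sprodC (f p)) (sprodC (g p)) => h; lra.
Qed.

Lemma derive_sprod_orthogonal (V : normedModType R) (D : set V)
    (f g : V -> 'rV[R]_4) (v p : V) :
  open D -> D p -> differentiable f p -> differentiable g p ->
  (forall q, D q -> sprod (f q) (g q) = 0) ->
  sprod ('D_v f p) (g p) = - sprod (f p) ('D_v g p).
Proof.
move=> Do Dp df dg fg.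
have : 'D_v (fun q => sprod (f q) (g q)) p = 'D_v (cst 0) p.
  by apply: (open_eq_derive v Do) => // q /[!inE]; exact: fg.
by rewrite (derive_sprod v df dg) derive_cst => h; lra.
Qed.

(** Pure algebra behind [isothermal_dalembertian_normal]: the four relations are
    the derivatives in u and v of the isothermality conditions, and the terms
    with mixed second derivatives cancel. *)
Lemma sprod_dalembertian (u v uu uv vu vv : 'rV[R]_4) (k l : R) :
  uv = vu -> sprod uu u = - sprod vu v -> sprod uv u = - sprod vv v ->
  sprod uu v = - sprod u vu -> sprod uv v = - sprod u vv ->
  sprod (vv - uu) (k *: u + l *: v) = 0.
Proof.
move=> <-; rewrite (sprodC u uv) (sprodC u vv) => h1 h2 h3 h4.
rewrite sprodBl !sprodDr !sprodZr.
have -> : sprod vv u = sprod uu u by rewrite h1 h4 opprK.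
have -> : sprod vv v = sprod uu v by rewrite h3 h2 opprK.
by rewrite subrr.
Qed.

Lemma dnjK (z : dnum R) : dnj R * (dnj R * z) = z.
Proof. by rewrite mulrA dnj2 mul1r. Qed.

Section Holomorphic.
Variables (D : set (dnum R)) (Psi : dnum R -> 'rV[dnum R]_4).
Hypotheses (Do : open D) (hP : vholomorphic_on D Psi).

Lemma cauchy_riemann (f : dnum R -> dnum R) t :
  d_tbar f t = 0 -> 'D_1 f t = dnj R * 'D_(dnj R) f t.
Proof.
move/eqP; rewrite scaler_eq0 invr_eq0 pnatr_eq0 /= subr_eq0.
by move/eqP.
Qed.

Lemma vd_t_vRe t (x := fun t => vRe (Psi t)) : D t ->
  vd_t Psi t = \row_i dn ('D_1 x t 0 i) ('D_(dnj R) x t 0 i).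
Proof.
move=> Dt; have sP i : smooth_on D (fun s => Psi s 0 i) by exact: (hP i).1.
have eu i := derive_vRe (1 : dnum R) i Do sP Dt.
have ev i := derive_vRe (dnj R) i Do sP Dt.
apply/rowP => i; rewrite [LHS]mxE [RHS]mxE.
apply: (etrans _ (congr2 (@dn R) (esym (eu i)) (esym (ev i)))).
rewrite /d_t.
have := cauchy_riemann ((hP i).2 t Dt).
set fu := 'D_1 _ t; set fv := 'D_(dnj R) _ t => ->.
by apply: dnP; rewrite !dnE; field.
Qed.

(** Psi_uu = (j Psi_v)_u = j (Psi_u)_v = j^2 Psi_vv. *)
Lemma holomorphic_wave t (x := fun t => vRe (Psi t)) : D t ->
  'D_1 ('D_1 x) t = 'D_(dnj R) ('D_(dnj R) x) t.
Proof.
move=> Dt; have sP i : smooth_on D (fun s => Psi s 0 i) by exact: (hP i).1.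
have sx := smooth_vRe Do sP.
apply/rowP => i; set f := fun s => Psi s 0 i.
have second w : 'D_w ('D_w x) t 0 i = dnre ('D_w ('D_w f) t).
  have dx := smooth_on_differentiable (smooth_on_derive w sx) Dt.
  have df := smooth_on_differentiable (smooth_on_derive w (sP i)) Dt.
  rewrite (derive_coord w i dx) -(derive_dnre w df).
  apply: (open_eq_derive w Do) => // s /[!inE] Ds.
  exact: (derive_vRe w i Do sP Ds).
apply: (etrans (second 1)); apply: (etrans _ (esym (second (dnj R)))).
apply: (congr1 (@dnre R)).
have CR s : D s -> 'D_1 f s = dnj R * 'D_(dnj R) f s.
  by move=> Ds; apply: cauchy_riemann; exact: (hP i).2.
have e w : 'D_w ('D_1 f) t = dnj R * 'D_w ('D_(dnj R) f) t.
  have df v := smooth_on_differentiable (smooth_on_derive v (sP i)) Dt.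
  rewrite -(derive_dnmull _ _ (df (dnj R))).
  by apply: (open_eq_derive w Do) => // s /[!inE]; exact: CR.
apply: (etrans (e 1)).
apply: (etrans (congr1 _ (schwarz (dnj R) (1 : dnum R) Do (sP i) Dt))).
exact: (etrans (congr1 _ (e (dnj R))) (dnjK _)).
Qed.

End Holomorphic.
End Geometry.

(** * Minimality and the wave equation *)

(** The coefficients are those of the orthogonal projection of [a] on the plane
    spanned by [u] and [v], whose Gram matrix is diagonal with entries E, -E. *)
Lemma sprod_project (R : realType) (u v a : 'rV[R]_4) (k l : R) :
  sprod u u = - sprod v v -> sprod u v = 0 -> sprod u u < 0 ->
  sprod (a - ((sprod a u / sprod u u) *: u + (- (sprod a v / sprod u u)) *: v))
    (k *: u + l *: v) = 0.
Proof.
move=> e1 e2 E0; have e3 : sprod v v = - sprod u u by rewrite e1 opprK.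
rewrite sprodBl sprodDl !sprodDr !sprodZl !sprodZr (sprodC v u) e2 e3.
by field; rewrite lt_eqF.
Qed.

(** A quadratic form with equal coefficients on both squares does not
    distinguish (a, b) from +-(b, a). *)
Lemma quadratic_flip (R : comNzRingType) (W : lmodType R) (a b c d : R)
    (A B C A' : W) :
  c ^+ 2 = b ^+ 2 -> d ^+ 2 = a ^+ 2 -> c * d = a * b -> A = A' ->
  (a * a) *: A + (a * b) *: B + (b * a) *: C + (b * b) *: A' =
  (c * c) *: A + (c * d) *: B + (d * c) *: C + (d * d) *: A'.
Proof.
rewrite !expr2 => -> -> e <-; rewrite (mulrC d) (mulrC b a) e.
by rewrite addrC !addrA [RHS]addrC !addrA; do 2 congr (_ + _); rewrite addrC.
Qed.

Lemma scaled_differences (R : pzRingType) (W : lmodType R) (k : R)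
    (a b a' b' n m : W) :
  n = m -> a = k *: a' -> b = k *: b' -> (b - m) - (a - n) = k *: (b' - a').
Proof. by move=> -> -> ->; rewrite opprB addrA subrK scalerBr. Qed.

Section Isothermal.
Variables (R : realType) (D : set (dnum R)) (x : dnum R -> 'rV[R]_4).
Hypotheses (Do : open D) (sx : smooth_on D x) (ix : isothermal D x).

Notation xu := ('D_1 x).
Notation xv := ('D_(dnj R) x).
Notation E p := (sprod (xu p) (xu p)).

Lemma diff_isothermal p w : D p -> 'd x p w = dnre w *: xu p + dnim w *: xv p.
Proof.
move=> Dp; have dx := smooth_on_differentiable sx Dp.
by rewrite -deriveE // (derive_dn w dx).
Qed.

Lemma sprod_tangent p w w' : D p -> sprod ('d x p w) ('d x p w') =
  E p * (dnre w * dnre w' - dnim w * dnim w').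
Proof.
move=> Dp; have [e1 e2 _] := ix Dp.
rewrite (diff_isothermal w Dp) (diff_isothermal w' Dp).
move: (xu p) (xv p) e1 e2 => u v e1 e2.
have e3 : sprod v v = - sprod u u by rewrite e1 opprK.
rewrite sprodDl !sprodDr !sprodZl !sprodZr (sprodC v u) e2 e3.
by ring.
Qed.

(** The induced metric E (du^2 - dv^2) is nondegenerate. *)
Lemma tangent_orthogonal_eq0 p w : D p ->
  (forall w', sprod ('d x p w) ('d x p w') = 0) -> w = 0.
Proof.
move=> Dp H; have [_ _ E0] := ix Dp.
have := H (dnj R); have := H 1.
rewrite (sprod_tangent w 1 Dp) (sprod_tangent w (dnj R) Dp) !dnE.
rewrite mulr1 !mulr0 subr0 sub0r mulr1 mulrN => /eqP + /eqP.
rewrite oppr_eq0 !mulf_eq0 (lt_eqF E0) /= => /eqP w1 /eqP w2.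
by apply: dnP; rewrite ?dn0re ?dn0im.
Qed.

(** The factor that normalises [x_u] to square -1 and [x_v] to square 1. *)
Definition isothermal_unit p : R := (Num.sqrt (- E p))^-1.

Lemma isothermal_unit2 p : D p -> isothermal_unit p ^+ 2 * E p = -1.
Proof.
move=> Dp; have [_ _ E0] := ix Dp.
rewrite /isothermal_unit exprVn sqr_sqrtr ?oppr_ge0 ?(ltW E0) //.
by rewrite invrN mulNr mulVf // lt_eqF.
Qed.

Lemma isothermal_frame p (c := isothermal_unit p) : D p ->
  orthonormal_frame x p (c *: 1) (c *: dnj R).
Proof.
move=> Dp; have H := isothermal_unit2 Dp.
split; rewrite (sprod_tangent _ _ Dp) !dnE.
- by rewrite -H /c; ring.
- by rewrite -[RHS]opprK -H /c; ring.
- by ring.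
Qed.

Lemma isothermal_timelike : connected D -> timelike_surface D x.
Proof.
move=> Dc; split=> //; last first.
  by move=> p Dp; eexists; eexists; exact: isothermal_frame.
split=> // p Dp w w' e; apply/eqP; rewrite -subr_eq0; apply/eqP.
apply: (tangent_orthogonal_eq0 Dp) => v.
by rewrite linearB /= e subrr /sprod !mxE; ring.
Qed.

(** [normal_part] is a choice; the orthogonal projection provided by
    [sprod_project] shows that there is something to choose. *)
Lemma normal_part_spec p a : D p ->
  normal_plane x p (normal_part x p a) /\
  tangent_plane x p (a - normal_part x p a).
Proof.
move=> Dp; have [e1 e2 E0] := ix Dp.
pose w := dn (sprod a (xu p) / E p) (- (sprod a (xv p) / E p)).
apply: (@xgetPex _ 0 [set n | normal_plane x p n /\ tangent_plane x p (a - n)]).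
exists (a - 'd x p w); split; last by exists w => //; rewrite opprB addrC subrK.
move=> _ [w' _ <-]; rewrite (diff_isothermal w Dp) (diff_isothermal w' Dp).
rewrite dnreE dnimE; exact: sprod_project.
Qed.

(** An orthonormal frame of the Lorentzian metric E (du^2 - dv^2) is (a, b),
    +-(b, a), since the orthogonal complement of (a, b) is the line through
    (b, a). *)
Lemma orthonormal_frame_flip p w1 w2 : D p -> orthonormal_frame x p w1 w2 ->
  [/\ dnre w2 ^+ 2 = dnim w1 ^+ 2, dnim w2 ^+ 2 = dnre w1 ^+ 2 &
      dnre w2 * dnim w2 = dnre w1 * dnim w1].
Proof.
move=> Dp []; have [_ _ E0] := ix Dp.
rewrite (sprod_tangent w1 w1 Dp) (sprod_tangent w2 w2 Dp).
rewrite (sprod_tangent w1 w2 Dp).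
move: (dnre w1) (dnim w1) (dnre w2) (dnim w2) => a b c d h1 h2.
move/eqP; rewrite mulf_eq0 (lt_eqF E0) /= subr_eq0 => /eqP h3.
have E1 := lt_eqF E0; move: (E p) E0 E1 h1 h2 => e E0 E1 h1 h2.
(* The two unit conditions read a^2 - b^2 = d^2 - c^2 = k. *)
pose k := - e^-1; have k0 : 0 < k by rewrite oppr_gt0 invr_lt0.
have h4 : a * a = b * b + k.
  by apply: (mulfI (negbT E1)); rewrite mulrDr /k mulrN mulfV ?E1 // -h1; ring.
have h5 : d * d = c * c + k.
  by apply: (mulfI (negbT E1)); rewrite mulrDr /k mulrN mulfV ?E1 // -h2; ring.
have h6 : c ^+ 2 = b ^+ 2.
  have : (a * a) * (c * c) = (b * b) * (d * d) by rewrite mulrACA h3; ring.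
  rewrite !expr2 h4 h5 mulrDl mulrDr => /addrI.
  by rewrite (mulrC _ k); move/(mulfI (lt0r_neq0 k0)).
have h7 : d ^+ 2 = a ^+ 2 by rewrite !expr2 in h6 *; rewrite h4 -h6 h5.
split => //; have a0 : a != 0.
  apply/eqP => a0; have : 0 < a * a by rewrite h4 ltr_wpDl // -expr2 sqr_ge0.
  by rewrite a0 mulr0 ltxx.
by apply: (mulfI a0); rewrite mulrA h3 -mulrA -expr2 h7; ring.
Qed.

Lemma wave_minimal : (forall p, D p -> 'D_1 xu p = 'D_(dnj R) xv p) ->
  minimal D x.
Proof.
move=> wave p w1 w2 Dp frame.
have [f1 f2 f3] := orthonormal_frame_flip Dp frame.
have second w := second_derive_lin Do sx Dp (dnum_basis w) (dnum_basis w).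
have e : 'D_w1 ('D_w1 x) p = 'D_w2 ('D_w2 x) p.
  apply: (etrans (second w1)); apply: (etrans _ (esym (second w2))).
  exact: (quadratic_flip _ _ f1 f2 f3 (wave p Dp)).
rewrite /mean_curvature /second_form.
apply: (etrans (congr1 (fun z => 2^-1 *: (- normal_part x p z + _)) e)).
by rewrite addNr scaler0.
Qed.

Lemma isothermal_dalembertian_normal p w : D p ->
  sprod ('D_(dnj R) xv p - 'D_1 xu p) ('d x p w) = 0.
Proof.
move=> Dp.
have dxu : differentiable xu p.
  exact: (smooth_on_differentiable (smooth_on_derive _ sx)).
have dxv : differentiable xv p.
  exact: (smooth_on_differentiable (smooth_on_derive _ sx)).
have dE v : sprod ('D_v xu p) (xu p) = - sprod ('D_v xv p) (xv p).
  by apply: derive_sprod_sqr_opp Do Dp dxu dxv _ => q /ix[].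
have dF v : sprod ('D_v xu p) (xv p) = - sprod (xu p) ('D_v xv p).
  by apply: derive_sprod_orthogonal Do Dp dxu dxv _ => q /ix[].
have sw := schwarz (1 : dnum R) (dnj R) Do sx Dp.
rewrite (diff_isothermal w Dp).
exact: sprod_dalembertian sw (dE 1) (dE (dnj R)) (dF 1) (dF (dnj R)).
Qed.

(** Evaluated on the frame proportional to [(x_u, x_v)], minimality says that
    x_uu and x_vv have the same normal part, so that x_vv - x_uu is tangent; it
    is also normal, hence zero. *)
Lemma minimal_wave p : minimal D x -> D p -> 'D_1 xu p = 'D_(dnj R) xv p.
Proof.
move=> mx Dp; pose c := isothermal_unit p.
have c0 : c != 0.
  apply/eqP => c0; have := isothermal_unit2 Dp; rewrite -/c c0 expr0n mul0r.
  by move/eqP; rewrite eq_sym oppr_eq0 oner_eq0.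
have second v := second_deriveZ c v Do sx Dp.
have [_ [w1 _ e1]] := normal_part_spec
  ('D_(c *: (1 : dnum R)) ('D_(c *: (1 : dnum R)) x) p) Dp.
have [_ [w2 _ e2]] := normal_part_spec
  ('D_(c *: dnj R) ('D_(c *: dnj R) x) p) Dp.
have := mx p _ _ Dp (isothermal_frame Dp).
rewrite /mean_curvature /second_form => /eqP.
rewrite scaler_eq0 invr_eq0 pnatr_eq0 /= addrC subr_eq0 => /eqP N.
have tangent : 'd x p (w2 - w1) = (c * c) *: ('D_(dnj R) xv p - 'D_1 xu p).
  apply: (etrans (linearB _ _ _)).
  apply: (etrans (congr2 (fun s t => s - t) e2 e1)).
  exact: (scaled_differences (esym N) (second 1) (second (dnj R))).
have w0 : w2 - w1 = 0.
  apply: (tangent_orthogonal_eq0 Dp) => w; rewrite tangent.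
  apply: (etrans (sprodZl _ _ _)).
  apply: (etrans (congr1 _ (isothermal_dalembertian_normal w Dp))).
  by rewrite mulr0.
move: tangent; rewrite w0 linear0.
move: ('D_(dnj R) xv p) ('D_1 xu p) => a b /esym/eqP.
by rewrite scaler_eq0 mulf_eq0 (negbTE c0) /= subr_eq0 => /eqP ->.
Qed.

End Isothermal.

(** * Null directions and d'Alembert's formula *)

Section Null.
Variable R : realType.

(** A ball is the union of the segments that join its centre to its points. *)
Lemma ball_connected (V : normedModType R) (p : V) (r : R) :
  connected (ball p r).
Proof.
pose seg (q : V) := (fun s : R => p + s *: (q - p)) @` `[0, 1].
rewrite (_ : ball p r = \bigcup_(q in ball p r) seg q).
  apply: bigcup_connected.
    exists p => q _; exists 0; first by rewrite /= in_itv /= lexx ler01.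
    by rewrite scale0r addr0.
  move=> q _; apply: connected_continuous_connected.
    exact: segment_connected.
  apply: continuous_subspaceT => s; apply: cvgD; first exact: cvg_cst.
  exact: scalel_continuous.
apply/seteqP; split=> q.
  move=> Bq; exists q => //; exists 1; first by rewrite /= in_itv /= ler01 lexx.
  by rewrite scale1r addrC subrK.
move=> [q' + [s]].
rewrite /= in_itv /= -ball_normE /ball_ /= => Bq' /andP[s0 s1] <-.
rewrite opprD addrA subrr sub0r normrN normrZ ger0_norm // distrC.
by rewrite (le_lt_trans _ Bq') // distrC ler_piMl.
Qed.

(** If the mixed derivative vanishes, ['D_v f] does not vary along [w], so by
    [mean_value_square] the second difference of [f] vanishes. *)
Lemma vanishing_mixed_derivative (V : normedModType R) (D : set V)
    (f : V -> R) (p v w : V) :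
  smooth_on D f -> (forall q, D q -> 'D_w ('D_v f) q = 0) ->
  (forall s t : R, 0 <= s <= 1 -> 0 <= t <= 1 -> D (p + s *: v + t *: w)) ->
  f (p + v + w) = f (p + v) + f (p + w) - f p.
Proof.
move=> sf f0 PD.
have i0 : 0 <= (0 : R) <= 1 by rewrite lexx ler01.
have i1 : 0 <= (1 : R) <= 1 by rewrite lexx ler01.
have df q : D q -> differentiable f q by exact: smooth_on_differentiable.
have [s s01|s s01|c c01 e] := @mean_value_square R V f p v w.
- by apply: df; have := PD s 0 s01 i0; rewrite scale0r addr0.
- by apply: df; have := PD s 1 s01 i1; rewrite scale1r.
have [t t01|d d01 e'] := @mean_value_segment R V ('D_v f) (p + c *: v) w.
  exact: (smooth_on_differentiable (smooth_on_derive v sf) (PD c t c01 t01)).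
move: e; rewrite e' f0; last exact: PD.
by move=> e; apply/eqP; rewrite -subr_eq0 -e; apply/eqP; ring.
Qed.

(** For z proportional to 1 + j and w to 1 - j, the iterated derivative is a
    multiple of f_uu - f_uv + f_vu - f_vv. *)
Lemma null_directions (D : set (dnum R)) (f : dnum R -> R) (z w p : dnum R) :
  open D -> smooth_on D f -> D p ->
  'D_1 ('D_1 f) p = 'D_(dnj R) ('D_(dnj R) f) p ->
  dnim z = dnre z -> dnim w = - dnre w -> 'D_w ('D_z f) p = 0.
Proof.
move=> Do sf Dp wave ez ew.
apply: (etrans (second_derive_lin Do sf Dp (dnum_basis z) (dnum_basis w))).
rewrite ez ew wave (schwarz_smooth (1 : dnum R) (dnj R) Do sf Dp).
move: ('D_(dnj R) ('D_(dnj R) f) p) ('D_1 ('D_(dnj R) f) p) => A B.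
by rewrite /GRing.scale /=; ring.
Qed.

End Null.

(** * A holomorphic map with prescribed real part *)

Section WaveLift.
Variable R : realType.

(** The complementary idempotents (1 + j)/2 and (1 - j)/2; their multiples are
    the two null lines. *)
Definition dnpos : dnum R := dn 2^-1 2^-1.
Definition dnneg : dnum R := dn 2^-1 (- 2^-1).

Lemma dnpos_dnneg : dnpos + dnneg = 1.
Proof. by apply: dnP; rewrite !dnE; field. Qed.

Lemma dnj_dnpos : dnj R * dnpos = dnpos.
Proof. by apply: dnP; rewrite !dnE; ring. Qed.

Lemma dnj_dnneg : dnj R * dnneg = - dnneg.
Proof. by apply: dnP; rewrite !dnE; ring. Qed.

Lemma dnim_dnposM (d : dnum R) : dnim (dnpos * d) = dnre (dnpos * d).
Proof. by rewrite !dnE; ring. Qed.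

Lemma dnim_dnnegM (d : dnum R) : dnim (dnneg * d) = - dnre (dnneg * d).
Proof. by rewrite !dnE; ring. Qed.

(** For [e] one of the two idempotents, the projection of [t] on a null line
    through [p], along the other null direction. *)
Definition null_proj (e p t : dnum R) : dnum R := p + dnmull e (t - p).

Lemma null_projE e p t : null_proj e p t = (p - e * p) + dnmull e t.
Proof. by rewrite /null_proj linearB /= /dnmull addrAC -addrA. Qed.

Lemma differentiable_null_proj e p t : differentiable (null_proj e p) t.
Proof.
rewrite (_ : null_proj e p = cst (p - e * p) + dnmull e).
  by apply: differentiableD => //; exact: differentiable_dnmull.
by apply/funext => s; rewrite null_projE.
Qed.

Lemma derive_null_proj e p t v : 'D_v (null_proj e p) t = dnmull e v.
Proof.
rewrite (_ : null_proj e p = cst (p - e * p) + dnmull e); last first.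
  by apply/funext => s; rewrite null_projE.
have dl := differentiable_dnmull e t.
rewrite (deriveD (derivable_cst _ _ _) (diff_derivable dl)) derive_cst add0r.
by rewrite deriveE // diff_lin //; exact: dnmull_continuous.
Qed.

(** The points are those of the null parallelogram with opposite corners [p]
    and [t]; it shrinks to [p] with [t - p]. *)
Lemma null_box (D : set (dnum R)) (p : dnum R) : open D -> D p ->
  exists2 r : R, 0 < r & forall (t : dnum R) (s s' : R), ball p r t ->
    0 <= s <= 1 -> 0 <= s' <= 1 ->
    D (p + s *: (dnpos * (t - p)) + s' *: (dnneg * (t - p))).
Proof.
move=> Do Dp.
have /nbhs_ballP[rho /= rho0 BD] : nbhs p D by exact: open_nbhs_nbhs.
have [k k0 lk] := linear_lipschitz (@dnmull_continuous R dnpos).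
have [l l0 ll] := linear_lipschitz (@dnmull_continuous R dnneg).
have kl0 : 0 < k + l by rewrite addr_gt0.
exists (rho / (k + l)); first by rewrite divr_gt0.
move=> t s s'; rewrite -ball_normE /ball_ /= distrC ltr_pdivlMr // => tp.
move=> /andP[s0 s1] /andP[s0' s1']; apply: BD.
rewrite -ball_normE /ball_ /= -addrA opprD addrA subrr sub0r normrN.
rewrite (le_lt_trans (ler_normD _ _)) // !normrZ !ger0_norm //.
apply: le_lt_trans tp; rewrite [leRHS]mulrDr; apply: lerD.
  by rewrite [leRHS]mulrC; apply: (le_trans _ (lk _)); rewrite ler_piMl.
by rewrite [leRHS]mulrC; apply: (le_trans _ (ll _)); rewrite ler_piMl.
Qed.

Section Wave.
Variables (D U : set (dnum R)) (x : dnum R -> 'rV[R]_4) (p : dnum R).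
Hypotheses (Do : open D) (sx : smooth_on D x) (Uo : open U).
Hypothesis box : forall (t : dnum R) (s s' : R), U t ->
  0 <= s <= 1 -> 0 <= s' <= 1 ->
  D (p + s *: (dnpos * (t - p)) + s' *: (dnneg * (t - p))).

(** The sum of the holomorphic extensions of the two travelling waves of x. *)
Definition wave_lift (t : dnum R) : 'rV[dnum R]_4 :=
  \row_i (coordZ i (2 *: dnpos) (x (null_proj dnpos p t))
          + coordZ i (2 *: dnneg) (x (null_proj dnneg p t))
          + (- x p 0 i) *: 1).

Let i0 : 0 <= (0 : R) <= 1. Proof. by rewrite lexx ler01. Qed.
Let i1 : 0 <= (1 : R) <= 1. Proof. by rewrite lexx ler01. Qed.

Lemma null_proj_dnpos t : U t -> D (null_proj dnpos p t).
Proof. by move=> Ut; have := box Ut i1 i0; rewrite scale1r scale0r addr0. Qed.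

Lemma null_proj_dnneg t : U t -> D (null_proj dnneg p t).
Proof. by move=> Ut; have := box Ut i0 i1; rewrite scale1r scale0r addr0. Qed.

Lemma null_projD t : null_proj dnpos p t + dnneg * (t - p) = t.
Proof.
by rewrite /null_proj /dnmull -addrA -mulrDl dnpos_dnneg mul1r addrC subrK.
Qed.

(** Multiplication by j fixes (1 + j)/2, both as coefficient of the first wave
    and as its direction, and changes both signs for (1 - j)/2; hence
    Psi_u = j Psi_v. *)
Lemma wave_lift_holomorphic : vholomorphic_on U wave_lift.
Proof.
move=> i.
have -> : (fun t => wave_lift t 0 i) = fun t =>
    (coordZ i (2 *: dnpos) (x (null_proj dnpos p t))
    + coordZ i (2 *: dnneg) (x (null_proj dnneg p t)))
    + cst ((- x p 0 i) *: 1) t.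
  by apply/funext => t; rewrite mxE.
have smooth e c : (forall t, U t -> D (null_proj e p t)) ->
    smooth_on U (fun t => coordZ i c (x (null_proj e p t)) : dnum R).
  move=> UD.
  exact: (smooth_on_affine_linear (@coordZ_continuous _ _ _ i c)
    (differentiable_null_proj e p) (derive_null_proj e p) Uo UD sx).
have sp := smooth dnpos (2 *: dnpos) null_proj_dnpos.
have sn := smooth dnneg (2 *: dnneg) null_proj_dnneg.
split.
  by apply: (smooth_onD Uo (smooth_onD Uo sp sn)); exact: smooth_on_cst.
move=> t Ut.
have dp := smooth_on_differentiable sp Ut.
have dn := smooth_on_differentiable sn Ut.
have der e c w : D (null_proj e p t) ->
    'D_w (fun t => coordZ i c (x (null_proj e p t)) : dnum R) t =
    coordZ i c ('D_(dnmull e w) x (null_proj e p t)).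
  move=> De; exact: (derive_affine_linear (@coordZ_continuous _ _ _ i c)
    (differentiable_null_proj e p) (derive_null_proj e p) w
    (smooth_on_differentiable sx De)).
have dpx := smooth_on_differentiable sx (null_proj_dnpos Ut).
have dnx := smooth_on_differentiable sx (null_proj_dnneg Ut).
have Dall w : 'D_w (fun t => (coordZ i (2 *: dnpos) (x (null_proj dnpos p t))
    + coordZ i (2 *: dnneg) (x (null_proj dnneg p t)))
    + cst ((- x p 0 i) *: 1) t) t
  = coordZ i (2 *: dnpos) ('D_(dnmull dnpos w) x (null_proj dnpos p t))
    + coordZ i (2 *: dnneg) ('D_(dnmull dnneg w) x (null_proj dnneg p t)).
  have d1 := diff_derivable (v := w) dp; have d2 := diff_derivable (v := w) dn.
  apply: (etrans (deriveD (derivableD d1 d2) (derivable_cst _ _ _))).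
  rewrite derive_cst addr0.
  apply: (etrans (deriveD d1 d2)).
  exact: (congr2 (fun a b : dnum R => a + b)
    (der dnpos (2 *: dnpos) w (null_proj_dnpos Ut))
    (der dnneg (2 *: dnneg) w (null_proj_dnneg Ut))).
rewrite /d_tbar (Dall 1) (Dall (dnj R)) /dnmull !mulr1.
rewrite ![_ * dnj R]mulrC dnj_dnpos dnj_dnneg.
have -> : 'D_(- dnneg) x (null_proj dnneg p t) =
    - 'D_dnneg x (null_proj dnneg p t).
  by rewrite -scaleN1r (deriveZl _ _ dnx) scaleN1r.
move: ('D_dnpos x _) ('D_dnneg x _) => A B.
by apply: dnP; rewrite /coordZ !dnE !mxE; field.
Qed.

(** This is d'Alembert's formula, by [vanishing_mixed_derivative] along the two
    sides of the null parallelogram. *)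
Lemma wave_lift_vRe t :
  (forall q, D q -> 'D_1 ('D_1 x) q = 'D_(dnj R) ('D_(dnj R) x) q) -> U t ->
  x t = vRe (wave_lift t).
Proof.
move=> wave Ut; apply/rowP => i; rewrite !mxE !dnE /coordZ.
have mixed q : D q ->
    'D_(dnneg * (t - p)) ('D_(dnpos * (t - p)) (fun s => x s 0 i)) q = 0.
  move=> Dq; apply: (null_directions Do (smooth_on_coord i Do sx) Dq).
  - apply: (etrans (esym (derive2_coord (1 : dnum R) (1 : dnum R) i Do sx Dq))).
    apply: (etrans _ (derive2_coord (dnj R) (dnj R) i Do sx Dq)).
    exact: (congr1 (fun z : 'rV[R]_4 => z 0 i) (wave q Dq)).
  - exact: dnim_dnposM.
  - exact: dnim_dnnegM.
have := vanishing_mixed_derivative (smooth_on_coord i Do sx) mixed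
  (fun s s' => box Ut).
rewrite -[p + dnpos * _]/(null_proj dnpos p t) null_projD => ->.
by rewrite -/(null_proj dnneg p t); field.
Qed.

End Wave.
End WaveLift.

(** * The representation theorem *)

Lemma isothermal_vd_t (R : realType) (D : set (dnum R))
    (Psi : dnum R -> 'rV[dnum R]_4) : open D -> vholomorphic_on D Psi ->
  isothermal D (fun t => vRe (Psi t)) <->
  (forall t, D t ->
    sprod (vd_t Psi t) (vd_t Psi t) = 0 /\ hnorm2 (vd_t Psi t) < 0).
Proof.
move=> Do hP.
have key (u v : 'rV[R]_4) :
    [/\ sprod u u = - sprod v v, sprod u v = 0 & sprod u u < 0] <->
    dn (sprod u u + sprod v v) (2 * sprod u v) = 0 /\
    sprod u u - sprod v v < 0.
  split=> [[e1 e2 E0]|[/[dup] /(congr1 (@dnre R)) + /(congr1 (@dnim R))]].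
    rewrite e2 mulr0; split; last by lra.
    by apply: dnP; rewrite !dnE // e1 addNr.
  by rewrite !dnE => e1 e2 E0; split; lra.
have vdE t : D t -> vd_t Psi t = _ := vd_t_vRe Do hP (t := t).
split=> H t Dt.
  by rewrite (vdE t Dt) sprod_dn hnorm2_dn; apply/key; exact: H.
by apply/key; have := H t Dt; rewrite (vdE t Dt) sprod_dn hnorm2_dn.
Qed.

Unset Implicit Arguments.
Set Strict Implicit.

Theorem theorem4p2 (R : realType) :
  (forall (D : set (dnum R)) (x : dnum R -> 'rV[R]_4),
     timelike_surface D x -> minimal D x -> isothermal D x ->
     forall p : dnum R, D p ->
     exists (U : set (dnum R)) (Psi : dnum R -> 'rV[dnum R]_4),
       [/\ domain U, U p & U `<=` D] /\
       [/\ vholomorphic_on U Psi,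
           forall t, U t -> x t = vRe (Psi t),
           forall t, U t -> sprod (vd_t Psi t) (vd_t Psi t) = 0 &
           forall t, U t -> hnorm2 (vd_t Psi t) < 0])
  /\
  (forall (D : set (dnum R)) (Psi : dnum R -> 'rV[dnum R]_4),
     domain D -> vholomorphic_on D Psi ->
     (forall t, D t -> sprod (vd_t Psi t) (vd_t Psi t) = 0) ->
     (forall t, D t -> hnorm2 (vd_t Psi t) < 0) ->
     let x := fun t => vRe (Psi t) in
     [/\ timelike_surface D x, minimal D x & isothermal D x]).
Proof.
split=> [D x [[Do _] [sx _] _] mx ix p Dp|D Psi [Do Dc] hP sq0 nm0 x].
  have [r r0 box] := null_box Do Dp.
  have Uo : open (ball p r) by exact: ball_open.
  have i1 : 0 <= (1 : R) <= 1 by rewrite lexx ler01.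
  have UD : ball p r `<=` D.
    move=> t Ut; have := box t 1 1 Ut i1 i1.
    by rewrite !scale1r -[p + _ * _]/(null_proj (dnpos R) p t) null_projD.
  have wave q Dq := minimal_wave Do sx ix mx (p := q) Dq.
  have hP := wave_lift_holomorphic sx Uo box.
  have xE t (Ut : ball p r t) := wave_lift_vRe Do sx box wave Ut.
  have iU : isothermal (ball p r) (fun t => vRe (wave_lift x p t)).
    move=> t Ut; have E w : 'D_w (fun t => vRe (wave_lift x p t)) t = 'D_w x t.
      by apply: (open_eq_derive w Uo) => // s /[!inE] /xE.
    by rewrite !E; exact: ix (UD t Ut).
  have null := (isothermal_vd_t Uo hP).1 iU.
  exists (ball p r), (wave_lift x p); split.
    by split=> //; [split=> //; exact: ball_connected|exact: ballxx].
  by split=> // t /null[].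
have ix : isothermal D x.
  by apply/(isothermal_vd_t Do hP) => t Dt; split; [exact: sq0|exact: nm0].
have sx : smooth_on D x by apply: smooth_vRe => // i; exact: (hP i).1.
split=> //; first exact: isothermal_timelike.
by apply: (wave_minimal Do sx ix) => t Dt; exact: (holomorphic_wave Do hP Dt).
Qed.
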